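(* Let $T/S$ be a semifield extension and fix an action of a finite group $G$ on $T$. For an intermediate semifield $M$ of $T/S$ let $G_M := \{ g \in G \mid g(m) = m \text{ for all } m \in M\}$, and for a subgroup $H$ of $G$ let $T^H := \{ t \in T \mid h(t) = t \text{ for all } h \in H\}$. Let $A$ be the set of all intermediate semifields $M$ of $T/S$ such that $M = T^{G_M}$, and let $B$ be the set of all subgroups of $G$. If the action of $G$ on $T$ is Galois for $T/S$, then the maps $\Phi : A \to B,\ M \mapsto G_M$ and $\Psi : B \to A,\ H \mapsto T^H$ (are well defined and) satisfy $\Psi \circ \Phi = \operatorname{id}_A$ and $\Phi \circ \Psi = \operatorname{id}_B$, and both reverse inclusions. Moreover, for any $M \in A$, the natural action of $G_M$ on $T$ (by restriction) is Galois for $T/M$.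
   Context: A semiring is a commutative semiring with an absorbing neutral element $0$ for addition and an identity $1$ for multiplication, with $0 \neq 1$. A semifield is a semiring in which every nonzero element is multiplicatively invertible. Semiring homomorphisms preserve $+$, $\cdot$, $0$ and $1$. A semifield extension $T/S$ is an injective semiring homomorphism $S \hookrightarrow T$ between semifields; $S$ is identified with its image, so $S \subset T$. An intermediate semifield of $T/S$ is a semifield $M$ with $S \subset M \subset T$ (as subsemifields). An action of a finite group $G$ on a semifield $T$ is always assumed to be by semiring automorphisms, i.e. to be given by a group homomorphism from $G$ to the automorphism group of $T$ (not assumed injective). The action of $G$ on $T$ is Galois for $T/S$ if (1) $T^G = S$, and (2) whenever $H_1, H_2$ are subgroups of $G$ with $T^{H_1} = T^{H_2}$, then $H_1 = H_2$. *)

(* Defs.v *)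
From HB Require Import structures.
From mathcomp Require Import all_boot all_order all_algebra all_fingroup.
From mathcomp Require Import boolp classical_sets functions.

Set Implicit Arguments.
Unset Strict Implicit.
Unset Printing Implicit Defensive.

Import GRing.Theory.

Local Open Scope ring_scope.
Local Open Scope classical_set_scope.

Definition semifield (T : comNzSemiRingType) : Prop :=
  forall x : T, x <> 0 -> exists y : T, x * y = 1.

Definition subsemifield (T : comNzSemiRingType) (M : set T) : Prop :=
  semiring_closed [pred x in M] /\
  (forall x : T, M x -> x <> 0 -> exists2 y : T, M y & x * y = 1).

Definition semifield_extension (S T : comNzSemiRingType)
    (iota : {rmorphism S -> T}) : Prop :=
  [/\ semifield S, semifield T & injective iota].

(* [S] is the copy of the base semifield inside [T]. *)
Definition intermediate_semifield (T : comNzSemiRingType) (S M : set T) : Prop :=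
  S `<=` M /\ subsemifield M.

(* [rho] restricted to [G] is a group homomorphism from [G] to the group of
   semiring automorphisms of [T] (a left action); the values of [rho] outside
   [G] are irrelevant. *)
Definition semiring_action (T : comNzSemiRingType) (gT : finGroupType)
    (G : {set gT}) (rho : gT -> {rmorphism T -> T}) : Prop :=
  {in G, forall g, bijective (rho g)} /\
  {in G &, forall g h, rho (g * h)%g =1 rho g \o rho h}.

Definition fixed_by (T : comNzSemiRingType) (gT : finGroupType)
    (rho : gT -> {rmorphism T -> T}) (H : {set gT}) : set T :=
  [set t | forall h, h \in H -> rho h t = t].

Definition pointwise_stabilizer (T : comNzSemiRingType) (gT : finGroupType)
    (G : {set gT}) (rho : gT -> {rmorphism T -> T}) (M : set T) : {set gT} :=
  [set g in G | `[< forall m, M m -> rho g m = m >]]%SET.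

Definition subgroups_of (gT : finGroupType) (G : {set gT}) : set {set gT} :=
  [set H : {set gT} | group_set H /\ H \subset G].

Definition galois_for (T : comNzSemiRingType) (gT : finGroupType)
    (G : {set gT}) (rho : gT -> {rmorphism T -> T}) (S : set T) : Prop :=
  fixed_by rho G = S /\
  (forall H1 H2 : {set gT}, subgroups_of G H1 -> subgroups_of G H2 ->
     fixed_by rho H1 = fixed_by rho H2 -> H1 = H2).

Definition galois_intermediate (T : comNzSemiRingType) (gT : finGroupType)
    (G : {set gT}) (rho : gT -> {rmorphism T -> T}) (S : set T) : set (set T) :=
  [set M | intermediate_semifield S M /\
           M = fixed_by rho (pointwise_stabilizer G rho M)].

(* Main.v *)
Require Import Defs.
From HB Require Import structures.
From mathcomp Require Import all_boot all_order all_algebra all_fingroup.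
From mathcomp Require Import boolp classical_sets functions.

Set Implicit Arguments.
Unset Strict Implicit.
Unset Printing Implicit Defensive.

Import GRing.Theory.

Local Open Scope ring_scope.
Local Open Scope classical_set_scope.

(* Fixed sets and pointwise stabilizers form an antitone Galois connection, so
   T^{G_{T^H}} = T^H for every subgroup H of G; the second Galois axiom then
   forces G_{T^H} = H.  Everything else is formal, once T^H is known to be a
   subsemifield (inverses are unique, hence fixed) and G_M a subgroup. *)

Section GaloisConnection.
Variables (T : comNzSemiRingType) (gT : finGroupType).
Variable rho : gT -> {rmorphism T -> T}.

Lemma in_pointwise_stabilizer (G : {set gT}) (M : set T) g :
  reflect (g \in G /\ forall m, M m -> rho g m = m)
          (g \in pointwise_stabilizer G rho M).
Proof.
by rewrite inE; apply: (iffP andP) => -[gG /asboolP].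
Qed.

Lemma pointwise_stabilizer_sub (G : {set gT}) (M : set T) :
  pointwise_stabilizer G rho M \subset G.
Proof. by apply/fintype.subsetP => g /in_pointwise_stabilizer[]. Qed.

Lemma pointwise_stabilizerS (G : {set gT}) (M1 M2 : set T) : M1 `<=` M2 ->
  pointwise_stabilizer G rho M2 \subset pointwise_stabilizer G rho M1.
Proof.
move=> sM; apply/fintype.subsetP => g /in_pointwise_stabilizer[gG fix2].
by apply/in_pointwise_stabilizer; split=> // m /sM/fix2.
Qed.

Lemma fixed_byS (H1 H2 : {set gT}) :
  H1 \subset H2 -> fixed_by rho H2 `<=` fixed_by rho H1.
Proof. by move=> /fintype.subsetP sH t fix2 h /sH/fix2. Qed.

Lemma sub_stabilizer_fixed_by (G H : {set gT}) : H \subset G ->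
  H \subset pointwise_stabilizer G rho (fixed_by rho H).
Proof.
move=> /fintype.subsetP sHG; apply/fintype.subsetP => h hH.
by apply/in_pointwise_stabilizer; split=> [|m]; [exact: sHG | exact].
Qed.

(** The triangle identity of the connection. The inclusion from left to right is antitonicity
    applied to H inside G_{T^H}, which uses that H lies in G because stabilizers are taken inside G;
    the other unfolds the stabilizer. *)
Lemma fixed_by_stabilizer_fixed_by (G H : {set gT}) : H \subset G ->
  fixed_by rho (pointwise_stabilizer G rho (fixed_by rho H)) = fixed_by rho H.
Proof.
move=> sHG; apply/seteqP; split.
  exact/fixed_byS/sub_stabilizer_fixed_by.
by move=> t tH g /in_pointwise_stabilizer[_]; apply.
Qed.

Lemma subsemifield_fixed_by (H : {set gT}) :
  semifield T -> subsemifield (fixed_by rho H).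
Proof.
move=> fT; split.
  split; split=> [|x y]; rewrite ?inE.
  - by move=> h _; rewrite rmorph0.
  - by move=> xH yH h hH; rewrite rmorphD xH ?yH.
  - by move=> h _; rewrite rmorph1.
  - by move=> xH yH h hH; rewrite rmorphM xH ?yH.
move=> x xH /fT[y xy1]; exists y => // h hH.
(* Since h fixes x, [rho h y] is again an inverse of x, so it equals y. *)
have xhy1 : x * rho h y = 1 by rewrite -[x](xH h) // -rmorphM xy1 rmorph1.
by rewrite -[LHS]mul1r -xy1 (mulrC x) -mulrA xhy1 mulr1.
Qed.

Lemma semiring_actionS (G H : {set gT}) :
  H \subset G -> semiring_action G rho -> semiring_action H rho.
Proof.
move=> /fintype.subsetP sHG [bijG homG]; split=> [g /sHG|g h /sHG gG /sHG]; first exact: bijG.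
exact: homG.
Qed.

(** [semiring_action] asks only for bijectivity and multiplicativity. As 1 * 1 = 1, the map [rho 1]
    is idempotent, and an injective idempotent map is the identity. *)
Lemma semiring_action1 (G : {group gT}) :
  semiring_action G rho -> rho 1%g =1 id.
Proof.
move=> [bijG homG] t; apply: (bij_inj (bijG _ (group1 G))).
by rewrite -[LHS](homG 1%g 1%g) ?group1 // mulg1.
Qed.

(** In a finite group a subset containing 1 and closed under products is a subgroup, so inverses
    need no separate check. *)
Lemma group_set_pointwise_stabilizer (G : {group gT}) (M : set T) :
  semiring_action G rho -> group_set (pointwise_stabilizer G rho M).
Proof.
move=> actG; apply/group_setP; split.
  apply/in_pointwise_stabilizer; split=> [|m _]; first exact: group1.
  exact: (semiring_action1 actG).
move=> g h /in_pointwise_stabilizer[gG fixg] /in_pointwise_stabilizer[hG fixh].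
apply/in_pointwise_stabilizer; split=> [|m Mm]; first exact: groupM.
by rewrite actG.2 //= fixh ?fixg.
Qed.

Lemma subgroups_of_pointwise_stabilizer (G : {group gT}) (M : set T) :
  semiring_action G rho -> subgroups_of G (pointwise_stabilizer G rho M).
Proof.
move=> actG; split; first exact: group_set_pointwise_stabilizer.
exact: pointwise_stabilizer_sub.
Qed.

Lemma stabilizer_fixed_by (G : {group gT}) (S : set T) (H : {set gT}) :
  semiring_action G rho -> galois_for G rho S -> subgroups_of G H ->
  pointwise_stabilizer G rho (fixed_by rho H) = H.
Proof.
move=> actG [_ galG] sH; apply: galG => //.
  exact: subgroups_of_pointwise_stabilizer.
exact/fixed_by_stabilizer_fixed_by/sH.2.
Qed.

Lemma galois_intermediate_fixed_by (G : {group gT}) (S : set T) (H : {set gT}) :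
  semifield T -> galois_for G rho S -> H \subset G ->
  galois_intermediate G rho S (fixed_by rho H).
Proof.
move=> fT [fixG _] sHG; split; last by rewrite fixed_by_stabilizer_fixed_by.
by split; [rewrite -fixG; exact: fixed_byS | exact: subsemifield_fixed_by].
Qed.

(** With T^H as base, the first axiom holds by reflexivity; the second is inherited because
    subgroups of H are subgroups of G. *)
Lemma galois_forS (G H : {set gT}) (S : set T) : H \subset G ->
  galois_for G rho S -> galois_for H rho (fixed_by rho H).
Proof.
move=> sHG [_ galG]; split=> // H1 H2 [gH1 sH1] [gH2 sH2].
by apply: galG; split=> //; exact: fintype.subset_trans sHG.
Qed.

End GaloisConnection.

Theorem theorem1p1 (S T : comNzSemiRingType) (iota : {rmorphism S -> T})
    (gT : finGroupType) (G : {group gT}) (rho : gT -> {rmorphism T -> T}) :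
  semifield_extension iota ->
  semiring_action G rho ->
  galois_for G rho (range iota) ->
  let A := galois_intermediate G rho (range iota) in
  let B := subgroups_of G in
  let Phi := pointwise_stabilizer G rho in
  let Psi := fixed_by rho in
  [/\ (forall M, A M -> B (Phi M)) /\ (forall H, B H -> A (Psi H)),
      forall M, A M -> Psi (Phi M) = M,
      forall H, B H -> Phi (Psi H) = H,
      (forall M1 M2, A M1 -> A M2 -> M1 `<=` M2 -> Phi M2 \subset Phi M1) /\
      (forall H1 H2, B H1 -> B H2 -> H1 \subset H2 -> Psi H2 `<=` Psi H1)
    & forall M, A M ->
        semiring_action (Phi M) rho /\ galois_for (Phi M) rho M].
Proof.
move=> [_ fT _] actG galG A B Phi Psi; split.
- split=> [M _|H [_ sHG]]; first exact: subgroups_of_pointwise_stabilizer.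
  exact: galois_intermediate_fixed_by.
(* Membership in [A] contains M = T^{G_M}; only the right-hand M is rewritten, not the one inside
   [Phi M]. *)
- by move=> M [_ {2}->].
- by move=> H; exact: stabilizer_fixed_by actG galG.
- split=> [M1 M2 _ _|H1 H2 _ _]; first exact: pointwise_stabilizerS.
  exact: fixed_byS.
- move=> M [_ ME]; have sPhi := pointwise_stabilizer_sub rho G M.
  split; first exact: semiring_actionS actG.
  (* Only the base M becomes T^{G_M}; the acting group stays [Phi M], so the restriction lemma
     applies with H = G_M. *)
  by rewrite [X in galois_for _ _ X]ME; exact: galois_forS galG.
Qed.
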